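(* Let $f\colon\mathbb{R}^n\to\overline{\mathbb{R}}$ be a lower semicontinuous function and $\overline{X}\in\mathbf{S}^n$ a symmetric matrix. Suppose that $f$ is locally symmetric around $\bar{x}:=\lambda(\overline{X})$, and let $M\subset\operatorname{dom} f$ be a set that is locally symmetric around $\bar{x}$. Let $\bar{v}\in\partial f(\bar{x})$, and let $U\in\mathbf{O}^n_{\overline{X}}$ be arbitrary. Then $M$ is identifiable (relative to $f$) at $\bar{x}$ for $\bar{v}$ if and only if $\lambda^{-1}(M)$ is identifiable (relative to $f\circ\lambda$) at $\overline{X}$ for $U^{T}(\operatorname{Diag}\bar{v})U\in\partial(f\circ\lambda)(\overline{X})$.
   Context: $\overline{\mathbb{R}}=\mathbb{R}\cup\{-\infty,+\infty\}$. $\mathbf{S}^n$ is the space of real $n\times n$ symmetric matrices with inner product $\langle X,Y\rangle=\mathrm{tr}(XY)$; $\mathbb{R}^n$ carries its standard inner product. $\lambda\colon\mathbf{S}^n\to\mathbb{R}^n$ sends $X$ to the vector of its eigenvalues in nonincreasing order, and $\lambda^{-1}(M)=\{X:\lambda(X)\in M\}$. $\mathbf{O}^n$ is the group of orthogonal $n\times n$ matrices and $\mathbf{O}^n_X:=\{U\in\mathbf{O}^n: X=U^T(\operatorname{Diag}\lambda(X))U\}$, where $\operatorname{Diag} v$ is the diagonal matrix with diagonal $v$. $\Sigma^n$ is the group of coordinate permutations of $\mathbb{R}^n$ and $\mathrm{Fix}(x)=\{\sigma\in\Sigma^n:\sigma x=x\}$. A function $f$ is locally symmetric around $\bar{x}$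 if $f(x)=f(\sigma x)$ for all $x$ near $\bar{x}$ and all $\sigma\in\mathrm{Fix}(\bar{x})$; a set is locally symmetric around $\bar x$ if its indicator function ($0$ on the set, $+\infty$ off it) is. Let $\mathbf{E}$ be a Euclidean space and $f\colon\mathbf{E}\to\overline{\mathbb{R}}$; $\operatorname{dom}f=\{x:f(x)<+\infty\}$. At a point $\bar x$ with $f(\bar x)$ finite, the Fréchet subdifferential $\hat\partial f(\bar x)$ is the set of $v\in\mathbf{E}$ with $f(x)\ge f(\bar x)+\langle v,x-\bar x\rangle+o(\|x-\bar x\|)$, and the limiting subdifferential $\partial f(\bar x)$ is the set of $v$ for which there exist $x_i\in\mathbf{E}$ and $v_i\in\hat\partial f(x_i)$ with $(x_i,f(x_i),v_i)\to(\bar x,f(\bar x),v)$; both are empty where $f$ is not finite. A set $M\subset\operatorname{dom}f$ is identifiable (relative to $f$) at $\bar x$ for $\bar v\in\partial f(\bar x)$ if for any sequences $(x_i,f(x_i),v_i)\to(\bar x,f(\bar x),\bar v)$ with $v_i\in\partial f(x_i)$, the points $x_i$ lie in $M$ for all sufficiently large $i$. *)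

(* Defs.v *)
From HB Require Import structures.
From mathcomp Require Import all_boot all_order all_fingroup all_algebra.
From mathcomp Require Import all_classical all_reals all_analysis.
From mathcomp Require complex.

Set Implicit Arguments.
Unset Strict Implicit.
Unset Printing Implicit Defensive.

Import Order.TTheory GRing.Theory Num.Theory.
Import numFieldNormedType.Exports.

Local Open Scope classical_set_scope.
Local Open Scope ring_scope.

Section Variational.
Context (R : realType) (E : lmodType R) (ip : {dot E for idfun}).
Implicit Types (f : E -> \bar R) (M : set E) (x v : E) (xs vs : nat -> E).

Definition ipnorm x : R := Num.sqrt (ip x x).

Definition ipcvg xs x : Prop := (fun i => ipnorm (xs i - x)) @ \oo --> (0 : R).

(* [f y >= f x + <v, y - x> + o(|y - x|)], the little-o being one-sided since
   [f y] may be [+oo]. *)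
Definition frechet_subdiff f x : set E :=
  [set v | f x \is a fin_num /\
    forall eps : R, 0 < eps -> exists2 delta : R, 0 < delta &
      forall y, ipnorm (y - x) < delta ->
        (f x + (ip v (y - x) - eps * ipnorm (y - x))%:E <= f y)%E].

Definition subdiff f x : set E :=
  [set v | f x \is a fin_num /\
    exists xs vs, [/\ forall i, frechet_subdiff f (xs i) (vs i),
      ipcvg xs x, f \o xs @ \oo --> f x & ipcvg vs v]].

(* The value [-oo] is allowed on the domain. *)
Definition edom f : set E := [set x | (f x < +oo)%E].

Definition identifiable f M x v : Prop :=
  [/\ M `<=` edom f, subdiff f x v &
    forall xs vs, (forall i, subdiff f (xs i) (vs i)) ->
      ipcvg xs x -> f \o xs @ \oo --> f x -> ipcvg vs v ->
      \forall i \near \oo, M (xs i)].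

End Variational.

Section LocalSymmetry.
Context (R : realType) (n : nat).
Implicit Types (x : 'rV[R]_n) (f : 'rV[R]_n -> \bar R) (M : set 'rV[R]_n).

Definition fixing_perms x : set 'S_n := [set s | col_perm s x = x].

Definition locally_symmetric f xbar : Prop :=
  \forall x \near xbar, forall s, fixing_perms xbar s -> f x = f (col_perm s x).

(* The indicator function of variational analysis, as opposed to [\1_M]. *)
Definition indicator M : 'rV[R]_n -> \bar R :=
  fun x => if x \in M then 0%E else +oo%E.

Definition locally_symmetric_set M xbar : Prop :=
  locally_symmetric (indicator M) xbar.

End LocalSymmetry.

Section RowDot.
Context (R : realType) (n : nat).

Definition rVdot (u v : 'rV[R]_n) : R := \sum_i u 0 i * v 0 i.

Let rVdot_bilinear : bilinear_for
  (GRing.Scale.Law.clone _ _ *%R _)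
  (GRing.Scale.Law.clone _ _ (idfun \; *%R) _) rVdot.
Proof.
split=> [w|w] a u v; rewrite /rVdot /= mulr_sumr -big_split /=;
  apply: eq_bigr => i _; rewrite !mxE.
- by rewrite mulrDl mulrA.
- by rewrite mulrDr mulrCA.
Qed.

HB.instance Definition _ :=
  bilinear_isBilinear.Build R 'rV[R]_n 'rV[R]_n R _ _ rVdot rVdot_bilinear.

Let rVdot_sym u v : rVdot u v = (-1) ^+ false * idfun (rVdot v u).
Proof.
by rewrite expr0 mul1r; apply: eq_bigr => i _; rewrite mulrC.
Qed.

HB.instance Definition _ :=
  isHermitianSesquilinear.Build R 'rV[R]_n false idfun rVdot rVdot_sym.

Let rVdot_gt0 u : u != 0 -> 0 < rVdot u u.
Proof.
move=> u0; rewrite lt0r sumr_ge0 ?andbT => [|i _]; last exact: sqr_ge0.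
apply: contraNneq u0 => u0; apply/eqP/rowP => i; rewrite mxE.
apply/eqP; rewrite -sqrf_eq0 expr2.
by move/psumr_eq0P: u0 => -> // j _; exact: sqr_ge0.
Qed.

HB.instance Definition _ := isDotProduct.Build R 'rV[R]_n rVdot rVdot_gt0.

End RowDot.

Section SymMatrices.
Context (R : realType) (n : nat).

Record symmx : Type :=
  SymMx { symmx_val :> 'M[R]_n; symmxP : symmx_val \is symmetricmx }.

HB.instance Definition _ := [isSub for symmx_val].
HB.instance Definition _ := [Choice of symmx by <:].

Lemma symmetricmxE (X : 'M[R]_n) : (X \is symmetricmx) = (X == X^T).
Proof. by rewrite is_hermitianmxE expr0 scale1r map_mx_id. Qed.

Fact symmetricmx_submod : submod_closed (symmetricmx : {pred 'M[R]_n}).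
Proof.
split=> [|a X Y]; rewrite ?symmetricmxE ?trmx0 // linearP /=.
by move=> /eqP <- /eqP <-.
Qed.

HB.instance Definition _ :=
  GRing.isSubmodClosed.Build R 'M[R]_n (symmetricmx : {pred 'M[R]_n})
    symmetricmx_submod.

HB.instance Definition _ := [SubChoice_isSubLmodule of symmx by <:].

Definition symdot (X Y : symmx) : R := \tr ((X : 'M[R]_n) *m Y).

Let symdot_bilinear : bilinear_for
  (GRing.Scale.Law.clone _ _ *%R _)
  (GRing.Scale.Law.clone _ _ (idfun \; *%R) _) symdot.
Proof.
split=> [Z|Z] a X Y; rewrite /symdot;
  have -> : symmx_val (a *: X + Y) = a *: (X : 'M[R]_n) + Y by [].
- by rewrite mulmxDl -scalemxAl linearP.
- by rewrite mulmxDr -scalemxAr linearP.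
Qed.

HB.instance Definition _ :=
  bilinear_isBilinear.Build R symmx symmx R _ _ symdot symdot_bilinear.

Let symdot_sym X Y : symdot X Y = (-1) ^+ false * idfun (symdot Y X).
Proof. by rewrite expr0 mul1r /symdot mxtrace_mulC. Qed.

HB.instance Definition _ :=
  isHermitianSesquilinear.Build R symmx false idfun symdot symdot_sym.

Let symdot_gt0 X : X != 0 -> 0 < symdot X X.
Proof.
move=> X0; have symdotE : symdot X X = \sum_i \sum_j X i j ^+ 2.
  apply: eq_bigr => i _; rewrite mxE; apply: eq_bigr => j _.
  have := symmxP X; rewrite symmetricmxE => /eqP XT.
  by rewrite expr2 [in X in _ * X = _]XT mxE.
have row_ge0 i : 0 <= \sum_j X i j ^+ 2.
  by apply: sumr_ge0 => j _; exact: sqr_ge0.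
rewrite symdotE lt0r sumr_ge0 ?andbT //.
apply: contraNneq X0 => X0; apply/eqP/val_inj/matrixP => i j.
rewrite [RHS]mxE; apply/eqP; rewrite -sqrf_eq0; apply/eqP.
have /psumr_eq0P := X0 => /(_ (fun i _ => row_ge0 i)) /(_ i isT).
by move/psumr_eq0P => -> // k _; exact: sqr_ge0.
Qed.

HB.instance Definition _ := isDotProduct.Build R symmx symdot symdot_gt0.

End SymMatrices.
Arguments symmx : clear implicits.

Section Eigenvalues.
Context (R : realType) (n : nat).
Implicit Types (X : symmx R n) (U : 'M[R]_n) (v : 'rV[R]_n).

(* [v] lists the roots of the characteristic polynomial, with multiplicity,
   in nonincreasing order. *)
Definition is_eigenvalues X v : Prop :=
  (forall i j : 'I_n, (i <= j)%N -> v 0 j <= v 0 i) /\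
  char_poly X = \prod_i ('X - (v 0 i)%:P).

(* Such a [v] is unique, and exists by [lambdaP], so the default [0] is never
   used. *)
Definition lambda X : 'rV[R]_n := xget 0 [set v | is_eigenvalues X v].

Import complex.

Let toC := real_complex R.

Lemma char_poly_split X :
  exists v : 'rV[R]_n, char_poly X = \prod_i ('X - (v 0 i)%:P).
Proof.
pose A := map_mx toC X.
have Asym : A \is symmetricmx.
  rewrite is_hermitianmxE expr0 scale1r map_mx_id // /A map_trmx.
  by have := symmxP X; rewrite symmetricmxE => /eqP <-.
have Areal : A \is a mxOver Num.real.
  by apply/mxOverP => i j; rewrite mxE; apply/complex_realP; eexists.
have Aherm := realsym_hermsym Asym Areal.
have /orthomx_spectralP AE := hermitian_normalmx Aherm.
have /mxOverP Dreal := hermitian_spectral_diag_real Aherm.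
exists (\row_i complex.Re (spectral_diag A 0 i)).
apply: (map_poly_inj toC); rewrite map_char_poly -/A.
have -> : char_poly A = char_poly (diag_mx (spectral_diag A)).
  rewrite [in LHS]AE; set P := spectralmx A; set D := diag_mx _.
  have Pu : P \in unitmx by exact: spectral_unit.
  rewrite /char_poly /char_poly_mx.
  have -> : 'X%:M - map_mx polyC (invmx P *m D *m P) =
      map_mx polyC (invmx P) *m ('X%:M - map_mx polyC D) *m map_mx polyC P.
    rewrite mulmxBr mulmxBl -!map_mxM /= scalar_mxC -(mulmxA 'X%:M) -map_mxM.
    by rewrite mulVmx // map_mx1 mulmx1.
  rewrite !det_mulmx mulrAC -det_mulmx -map_mxM mulVmx // map_mx1 det1.
  by rewrite mul1r.
rewrite char_poly_trig ?diag_mx_is_trig // rmorph_prod /=.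
apply: eq_bigr => i _; rewrite rmorphB /= map_polyX map_polyC /= !mxE eqxx.
by rewrite mulr1n /toC RRe_real.
Qed.

Lemma lambdaP X : is_eigenvalues X (lambda X).
Proof.
apply: xgetPex; have [v vE] := char_poly_split X.
pose s := sort >=%R [seq v 0 i | i : 'I_n].
have szs : size s = n by rewrite size_sort size_map size_enum_ord.
exists (\row_i s`_i); split=> [i j ij|].
  rewrite !mxE; apply: (sorted_leq_nth ge_trans ge_refl) => //.
  - by apply: sort_sorted => x y; exact: le_total.
  - by rewrite inE szs.
  - by rewrite inE szs.
rewrite vE; transitivity (\prod_(x <- s) ('X - x%:P)).
  rewrite (perm_big [seq v 0 i | i : 'I_n]) ?perm_sort // big_map.
  by rewrite big_enum.
by rewrite (big_nth 0) szs big_mkord; apply: eq_bigr => i _; rewrite mxE.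
Qed.

Definition orthogonal_mx U : Prop := U *m U^T = 1%:M.

Fact conj_diag_sym U v : U^T *m diag_mx v *m U \is symmetricmx.
Proof. by rewrite symmetricmxE !trmx_mul tr_diag_mx trmxK mulmxA. Qed.

Definition conj_diag U v : symmx R n := SymMx (conj_diag_sym U v).

Definition diagonalizers X : set 'M[R]_n :=
  [set U | orthogonal_mx U /\ X = conj_diag U (lambda X)].

End Eigenvalues.

Arguments rVdot {R n} u v.
Arguments symdot {R n} X Y.
Arguments lambda {R n} X.
Arguments conj_diag {R n} U v.

(* Main.v *)
Require Import Defs.
From mathcomp Require Import all_boot all_order all_fingroup all_algebra.
From mathcomp Require Import all_classical all_reals all_analysis.
From mathcomp Require Import ring lra.

Set Implicit Arguments.
Unset Strict Implicit.
Unset Printing Implicit Defensive.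

Import Order.TTheory GRing.Theory Num.Theory numFieldNormedType.Exports.

Local Open Scope classical_set_scope.
Local Open Scope ring_scope.

(** Write [F = f \o lambda]. Everything rests on one inequality of Fan,
    [<X, Y> <= <lambda X, lambda Y>] ([symdot_le_lambda]). Together
    with [|lambda X| = |X|] it makes [lambda] 1-Lipschitz ([dist_lambda]), and it replaces both the perturbation theory of
    eigenvalues and any compactness of the orthogonal group.

    The core is the description of subgradients of [F] near [Xbar]: they are the
    matrices [U^T Diag(v) U] with [U] diagonalizing [X] and [v] a subgradient of
    [f] at [lambda X].

    - Let [v] be a Frechet subgradient of [f] at a sorted [x], and put
      [X = U^T Diag(x) U] and [V = U^T Diag(v) U]. For small [t > 0]
      the spectrum of [U^T Diag(x + t v) U] is [x + t v'], where [v'] permutes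
      [v] by a permutation fixing [x]; by local symmetry [v'] is again a
      subgradient at [x]. Fan's inequality against [x + t v'] bounds
      [<v', lambda Y - x>] from below by [<V, Y - X> - |Y - X|^2 / (2 t)], which
      gives the subgradient inequality for [F], the last term being of second
      order ([frechet_lambda]).
    - Conversely, let [V] be a Frechet subgradient of [F] at [X]. Projecting
      [X + t V] on the orbit of [X] gives [Y] with [lambda Y = lambda X], commuting
      with [X + t V]. Optimality of the projection gives
      [|Y - X|^2 <= 2 t <V, Y - X>], while [F Y = F X] makes [<V, Y - X>]
      negligible with respect to [|Y - X|]; hence [|Y - X| = o(t)], and in the
      limit [X] and [V] commute ([frechet_spectral_comm]). They are then
      diagonalized together, and restricting the subgradient inequality to
      matrices diagonal in the same basis finishes the case
      ([frechet_lambda_inv]).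
    - For limiting subgradients one needs that if [X_i -> X] and [V_i -> V] with
      [X_i], [V_i] diagonalized together, and so are [X], [V], then the diagonals
      of [V_i] converge to that of [V] after permutations fixing [lambda X]
      ([joint_spectrum_cvg]). This follows by comparing the spectra of
      [X_i + t V_i] and [X + t V] for one small [t].

    Identifiability is then transported along these descriptions. A sequence
    [(x_i, v_i)] for [f] lifts to [(U^T Diag(x_i) U, U^T Diag(v_i) U)], whose
    spectra are obtained from the [x_i] by permutations fixing [xbar].
    A sequence [(X_i, V_i)] for [F] is diagonalized, and [joint_spectrum_cvg] permutes the diagonals so that
    they converge to [(xbar, vbar)]; local symmetry of [M] undoes the
    permutations. *)

(** * Norms, convergence and subgradients in an inner product space *)

Section NormTheory.
Context {R : realType} {E : lmodType R} (ip : {dot E for idfun}).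
Implicit Types (u v w : E) (us : nat -> E).

Lemma ipC u v : ip u v = ip v u.
Proof. by rewrite hermC expr0 mul1r. Qed.

Lemma ipZl a u v : ip (a *: u) v = a * ip u v.
Proof. exact: linearZl_LR. Qed.

Lemma ipZr a u v : ip u (a *: v) = a * ip u v.
Proof. exact: linearZr_LR. Qed.

Lemma ipDl u v w : ip (u + v) w = ip u w + ip v w.
Proof. exact: linearDl. Qed.

Lemma ipDr u v w : ip u (v + w) = ip u v + ip u w.
Proof. exact: linearD. Qed.

Lemma ipBl u v w : ip (u - v) w = ip u w - ip v w.
Proof. exact: linearBl. Qed.

Lemma ipBr u v w : ip u (v - w) = ip u v - ip u w.
Proof. exact: linearB. Qed.

Lemma ip_gt0 u : u != 0 -> 0 < ip u u.
Proof. exact: neq0_dnorm_gt0. Qed.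

Lemma ip_ge0 u : 0 <= ip u u.
Proof.
have [->|u0] := eqVneq u 0; first by rewrite linear0l.
exact/ltW/ip_gt0.
Qed.

Lemma ipnorm_ge0 u : 0 <= ipnorm ip u.
Proof. exact: sqrtr_ge0. Qed.

Lemma sqr_ipnorm u : ipnorm ip u ^+ 2 = ip u u.
Proof. by rewrite /ipnorm sqr_sqrtr ?ip_ge0. Qed.

Lemma ipnorm0 : ipnorm ip 0 = 0.
Proof. by rewrite /ipnorm linear0l sqrtr0. Qed.

Lemma ipnorm_eq0 u : ipnorm ip u = 0 -> u = 0.
Proof.
move=> u0; apply/eqP; apply: contraT => /ip_gt0.
by rewrite -sqr_ipnorm u0 expr0n ltxx.
Qed.

Lemma ipBB u v : ip (u - v) (u - v) = ip u u - 2 * ip u v + ip v v.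
Proof. by rewrite ipBl !ipBr (ipC v u); ring. Qed.

Lemma ipnormN u : ipnorm ip (- u) = ipnorm ip u.
Proof. by rewrite /ipnorm linearNl linearN opprK. Qed.

Lemma ipnormBC u v : ipnorm ip (u - v) = ipnorm ip (v - u).
Proof. by rewrite -ipnormN opprB. Qed.

Lemma ipnormZ a u : ipnorm ip (a *: u) = `|a| * ipnorm ip u.
Proof.
rewrite /ipnorm ipZl ipZr mulrA -expr2 sqrtrM ?sqr_ge0 //.
by rewrite sqrtr_sqr.
Qed.

Lemma CauchySchwarz_ip u v : ip u v <= ipnorm ip u * ipnorm ip v.
Proof.
have [->|v0] := eqVneq v 0; first by rewrite linear0r ipnorm0 mulr0.
have vv0 : 0 < ip v v by exact: ip_gt0.
have N0 : 0 <= ipnorm ip u * ipnorm ip v by rewrite mulr_ge0 ?ipnorm_ge0.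
have [uv0|uv0] := leP 0 (ip u v); last exact: le_trans (ltW uv0) N0.
rewrite -(ler_pXn2r (n := 2)) ?nnegrE // exprMn !sqr_ipnorm.
have := ip_ge0 (ip v v *: u - ip u v *: v).
rewrite ipBB !ipZl !ipZr => h.
rewrite -(ler_pM2l vv0) -subr_ge0; apply: le_trans h _.
by rewrite le_eqVlt; apply/orP; left; apply/eqP; ring.
Qed.

Lemma ipnorm_triangle u v : ipnorm ip (u + v) <= ipnorm ip u + ipnorm ip v.
Proof.
rewrite -(ler_pXn2r (n := 2)) ?nnegrE ?addr_ge0 ?ipnorm_ge0 //.
rewrite sqr_ipnorm ipDl !ipDr (ipC v u) sqrrD !sqr_ipnorm.
by have := CauchySchwarz_ip u v; lra.
Qed.

Lemma ipnorm_dist u v w :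
  ipnorm ip (u - w) <= ipnorm ip (u - v) + ipnorm ip (v - w).
Proof. by rewrite -[u - w](subrKA v) ipnorm_triangle. Qed.

Lemma ipcvgP us u : ipcvg ip us u <->
  forall eps, 0 < eps -> \forall i \near \oo, ipnorm ip (us i - u) < eps.
Proof.
rewrite /ipcvg cvgr0Pnorm_lt; split=> h eps e0; have := h _ e0;
  by apply: filterS => i; rewrite ger0_norm ?ipnorm_ge0.
Qed.

Lemma ipcvg_shift us u N : ipcvg ip us u -> ipcvg ip (fun i => us (i + N)%N) u.
Proof.
by rewrite /ipcvg -(cvg_shiftn N (fun i => ipnorm ip (us i - u))).
Qed.

Lemma ipcvg_eventually us ws u : (\forall i \near \oo, us i = ws i) ->
  ipcvg ip us u -> ipcvg ip ws u.
Proof.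
move=> uw /ipcvgP h; apply/ipcvgP => e e0.
by have := h _ e0; apply: filterS2 uw => i ->.
Qed.

Lemma ipcvg_norm_lt us u w r : ipcvg ip us u -> ipnorm ip (u - w) < r ->
  \forall i \near \oo, ipnorm ip (us i - w) < r.
Proof.
move=> /ipcvgP h ur; have := h (r - ipnorm ip (u - w)).
rewrite subr_gt0 => /(_ ur); apply: filterS => i.
by rewrite ltrBrDr; apply: le_lt_trans; exact: ipnorm_dist.
Qed.

(** The definitions quantify over sequences whose terms are all subgradients,
    whereas local symmetry provides subgradients only close to the limit; the two
    lemmas below drop the first terms. *)
Lemma subdiff_eventually (f : E -> \bar R) x v xs vs :
  f x \is a fin_num -> (\forall i \near \oo, frechet_subdiff ip f (xs i) (vs i)) ->
  ipcvg ip xs x -> f \o xs @ \oo --> f x -> ipcvg ip vs v ->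
  subdiff ip f x v.
Proof.
move=> fx [N _ fN] xsx fxs vsv; split=> //.
exists (fun i => xs (i + N)%N), (fun i => vs (i + N)%N); split.
- by move=> i; apply: fN => /=; rewrite leq_addl.
- exact: ipcvg_shift.
- by rewrite -(cvg_shiftn N) in fxs.
- exact: ipcvg_shift.
Qed.

Lemma identifiable_eventually (f : E -> \bar R) M x v xs vs :
  identifiable ip f M x v ->
  (\forall i \near \oo, subdiff ip f (xs i) (vs i)) ->
  ipcvg ip xs x -> f \o xs @ \oo --> f x -> ipcvg ip vs v ->
  \forall i \near \oo, M (xs i).
Proof.
move=> [_ _ idM] [N _ fN] xsx fxs vsv.
have [||||K _ KM] := idM (fun i => xs (i + N)%N) (fun i => vs (i + N)%N).
- by move=> i; apply: fN => /=; rewrite leq_addl.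
- exact: ipcvg_shift.
- by rewrite -(cvg_shiftn N) in fxs.
- exact: ipcvg_shift.
exists (K + N)%N => // i /= Ki.
have Ni : (N <= i)%N by apply: leq_trans Ki; exact: leq_addl.
by rewrite -(subnK Ni); apply: KM; rewrite /= leq_subRL // addnC.
Qed.

End NormTheory.

(** * Simultaneous diagonalization *)

Section Spectral.
Context {R : realType}.

(** Start from an eigenvector [u] of [A]. By Cayley-Hamilton the product of the
    [B - y_i], [y_i] the eigenvalues of [B], kills [u]; the last nonzero partial
    product applied to [u] is an eigenvector of [B], and it is still one of [A]
    because all factors commute with [A]. *)
Lemma common_eigenvector n (A B : 'M[R]_n.+1) :
  A^T = A -> B^T = B -> A *m B = B *m A ->
  exists u : 'rV_n.+1, exists a b,
    [/\ u != 0, u *m A = a *: u & u *m B = b *: u].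
Proof.
move=> At Bt AB.
have As : A \is symmetricmx by rewrite symmetricmxE At.
have Bs : B \is symmetricmx by rewrite symmetricmxE Bt.
have [x xE] := char_poly_split (SymMx As).
have [y yE] := char_poly_split (SymMx Bs).
have : eigenvalue A (x 0 0).
  rewrite eigenvalue_root_char [char_poly A]xE.
  by rewrite /root (bigD1 ord0) //= hornerM hornerXsubC subrr mul0r.
move=> /eigenvalueP[u uA u0].
have : u *m \prod_(c <- [seq y 0 i | i <- index_enum 'I_n.+1]) (B - c%:M) = 0.
  rewrite big_map.
  have := Cayley_Hamilton B; rewrite [char_poly B]yE rmorph_prod /= => CH.
  set P := \prod_(c <- _) _; suff -> : P = 0 by rewrite mulmx0.
  rewrite -[RHS]CH; apply: eq_bigr => i _.
  by rewrite rmorphB /= horner_mx_X horner_mx_C.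
move: [seq y 0 i | i <- index_enum 'I_n.+1] => s.
elim: s u u0 uA => [|c s IHs] u u0 uA.
  by rewrite big_nil mulmx1 => u00; rewrite u00 eqxx in u0.
rewrite big_cons -mulmxE mulmxA => us.
have [ucB|ucB] := eqVneq (u *m (B - c%:M)) 0; last first.
  apply: IHs ucB _ us.
  rewrite -mulmxA mulmxBl -scalar_mxC -AB -mulmxBr mulmxA uA.
  by rewrite scalemxAl.
exists u, (x 0 0), c; split=> //.
by apply/eqP; rewrite -subr_eq0 -mul_mx_scalar -mulmxBr ucB.
Qed.

Lemma norm_mx11 n (u : 'rV[R]_n) : u *m u^T = (rVdot u u)%:M.
Proof.
apply/matrixP => i j; rewrite !ord1 !mxE eqxx mulr1n.
by apply: eq_bigr => k _; rewrite mxE.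
Qed.

(** Any unit vector is the first row of an orthogonal matrix: the Householder
    reflection exchanging it with the first basis vector. *)
Lemma orthogonal_row n (u : 'rV[R]_n.+1) : rVdot u u = 1 ->
  exists H : 'M[R]_n.+1, orthogonal_mx H /\ row 0 H = u.
Proof.
move=> u1; pose e : 'rV[R]_n.+1 := delta_mx 0 0.
have e1 : rVdot e e = 1.
  rewrite /rVdot (bigD1 ord0) //= big1 => [|i i0].
    by rewrite !mxE eqxx mulr1 addr0.
  by rewrite !mxE (negPf i0) andbF mulr0.
have [ue|ue] := eqVneq u e.
  by exists 1%:M; rewrite /orthogonal_mx trmx1 mulmx1 row1 ue.
pose w := e - u.
have w0 : rVdot w w != 0.
  by apply/lt0r_neq0/ip_gt0; rewrite subr_eq0 eq_sym.
have ew : rVdot w w = 2 * rVdot e w.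
  rewrite /w ipBB ipBr /= e1 u1; ring.
pose k := 2 / rVdot w w.
pose H := 1%:M - k *: (w^T *m w).
have Ht : H^T = H by rewrite /H linearB /= trmx1 linearZ /= trmx_mul trmxK.
exists H; split.
  have SS : w^T *m w *m (w^T *m w) = rVdot w w *: (w^T *m w).
    by rewrite mulmxA -(mulmxA w^T) norm_mx11 mul_mx_scalar scalemxAl.
  rewrite /orthogonal_mx Ht /H mulmxBr mulmx1 mulmxBl mul1mx.
  rewrite -scalemxAl -scalemxAr SS !scalerA.
  rewrite -addrA -opprD -[RHS]subr0; congr (_ - _).
  rewrite -scalerBl -scalerDl [X in X *: _](_ : _ = 0) ?scale0r //.
  by rewrite /k; field.
rewrite rowE -/e /H mulmxBr mulmx1 -scalemxAr mulmxA.
have -> : e *m w^T = (rVdot e w)%:M.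
  apply/matrixP => i j; rewrite !ord1 !mxE eqxx mulr1n.
  by apply: eq_bigr => l _; rewrite !mxE.
rewrite mul_scalar_mx scalerA (_ : k * rVdot e w = 1) ?scale1r ?subKr //.
by rewrite /k ew in w0 *; field; move: w0; rewrite mulf_eq0 negb_or => /andP[].
Qed.

Lemma orthogonal_mxV n (U : 'M[R]_n) : orthogonal_mx U -> U^T *m U = 1%:M.
Proof. exact: mulmx1C. Qed.

Lemma orthogonal_mxM n (U V : 'M[R]_n) :
  orthogonal_mx U -> orthogonal_mx V -> orthogonal_mx (U *m V).
Proof.
rewrite /orthogonal_mx => UU VV.
by rewrite trmx_mul mulmxA -(mulmxA U) VV mulmx1.
Qed.

Lemma deflation n (A H : 'M[R]_(1 + n)) a :
  A^T = A -> orthogonal_mx H -> row 0 H *m A = a *: row 0 H ->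
  exists A' : 'M[R]_n, A'^T = A' /\ H *m A *m H^T = block_mx a%:M 0 0 A'.
Proof.
move=> At HH Ha; set B := H *m A *m H^T.
have Bt : B^T = B by rewrite /B !trmx_mul trmxK At mulmxA.
have B0 : usubmx B = row_mx a%:M 0.
  apply/row_matrixP => i; rewrite !ord1.
  have -> : row 0 (usubmx B) = row 0 B by apply/rowP => j; rewrite !mxE lshift0.
  rewrite /B !row_mul Ha -scalemxAl -row_mul [H *m _]HH row1.
  apply/rowP => j; rewrite !mxE; case: splitP => k /= jk; rewrite !mxE.
    by rewrite !ord1 (_ : j = 0) ?mulr1 //; apply/val_inj; rewrite /= jk ord1.
  rewrite (_ : j == 0 = false) ?mulr0 //.
  by apply/eqP=> /(congr1 val); rewrite /= jk.
have Bu : ulsubmx B = a%:M by rewrite /ulsubmx B0 row_mxKl.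
have Br : ursubmx B = 0 by rewrite /ursubmx B0 row_mxKr.
have Bd : dlsubmx B = 0 by rewrite -[B]Bt -trmx_ursub Br trmx0.
exists (drsubmx B); split; first by rewrite trmx_drsub Bt.
by rewrite -[LHS]submxK Bu Br Bd.
Qed.

(** By induction on the dimension: in an orthonormal basis starting with a common
    eigenvector, both matrices split off their first row and column, and the
    remaining blocks commute. *)
Lemma joint_diagonalization n (A B : 'M[R]_n) :
  A^T = A -> B^T = B -> A *m B = B *m A ->
  exists U : 'M[R]_n, [/\ orthogonal_mx U, is_diag_mx (U *m A *m U^T)
    & is_diag_mx (U *m B *m U^T)].
Proof.
elim: n A B => [|n IHn] A B At Bt AB.
  exists 1%:M; split; first by rewrite /orthogonal_mx trmx1 mulmx1.
    by apply/is_diag_mxP => -[].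
  by apply/is_diag_mxP => -[].
have [u [a [b [u0 uA uB]]]] := common_eigenvector At Bt AB.
pose c := Num.sqrt (rVdot u u).
have uu0 : 0 < rVdot u u by exact: ip_gt0.
have c0 : c != 0 by rewrite lt0r_neq0 // sqrtr_gt0.
have u1 : rVdot (c^-1 *: u) (c^-1 *: u) = 1.
  have cc : c ^+ 2 = rVdot u u by rewrite sqr_sqrtr // ltW.
  by rewrite ipZl ipZr /= -cc; field.
have [H [HH Hu]] := orthogonal_row u1.
have [A' [A't HA]] : exists A' : 'M[R]_n, A'^T = A' /\
    H *m A *m H^T = block_mx a%:M 0 0 A' :> 'M[R]_(1 + n).
  apply: deflation => //.
  by rewrite Hu -scalemxAl uA !scalerA mulrC.
have [B' [B't HB]] : exists B' : 'M[R]_n, B'^T = B' /\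
    H *m B *m H^T = block_mx b%:M 0 0 B' :> 'M[R]_(1 + n).
  apply: deflation => //.
  by rewrite Hu -scalemxAl uB !scalerA mulrC.
have conjM X Y : H *m X *m H^T *m (H *m Y *m H^T) = H *m (X *m Y) *m H^T.
  by rewrite !mulmxA -(mulmxA (_ *m X)) (orthogonal_mxV HH) mulmx1.
have [U' [UU UA UB]] : exists U' : 'M[R]_n, [/\ orthogonal_mx U',
    is_diag_mx (U' *m A' *m U'^T) & is_diag_mx (U' *m B' *m U'^T)].
  apply: IHn => //.
  have : H *m A *m H^T *m (H *m B *m H^T) = H *m B *m H^T *m (H *m A *m H^T).
    by rewrite !conjM AB.
  rewrite HA HB => comm; have {comm} :
    block_mx a%:M 0 0 A' *m block_mx b%:M 0 0 B'
    = block_mx b%:M 0 0 B' *m block_mx a%:M 0 0 A' :> 'M[R]_(1 + n) := comm.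
  by rewrite !mulmx_block => /eq_block_mx[_ _ _]; rewrite !mul0mx !add0r.
pose W : 'M[R]_(1 + n) := block_mx 1%:M 0 0 U'.
have WX x X' :
    W *m block_mx x 0 0 X' *m W^T = block_mx x 0 0 (U' *m X' *m U'^T).
  rewrite /W tr_block_mx trmx1 !trmx0 !mulmx_block.
  by rewrite !(mul0mx, mulmx0, mul1mx, mulmx1, addr0, add0r).
have WHX X : W *m H *m X *m (W *m H)^T = W *m (H *m X *m H^T) *m W^T.
  by rewrite trmx_mul !mulmxA.
have diag1 (x : 'M[R]_1) (Y : 'M[R]_n) :
    is_diag_mx Y -> is_diag_mx (block_mx x 0 0 Y : 'M[R]_(1 + n)).
  by move=> Yd; rewrite is_diag_block_mx // !eqxx mx11_is_diag.
exists (W *m H); split.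
- apply: orthogonal_mxM => //.
  rewrite /orthogonal_mx -[W *m W^T](_ : W *m block_mx 1%:M 0 0 1%:M *m W^T = _).
    by rewrite WX mulmx1 [U' *m _]UU -scalar_mx_block.
  by rewrite -scalar_mx_block mulmx1.
- by rewrite WHX HA WX; exact: diag1.
- by rewrite WHX HB WX; exact: diag1.
Qed.

End Spectral.

(** * Eigenvalues and orthogonal conjugation *)

Definition nonincreasing_row {R : realType} {n : nat} (x : 'rV[R]_n) : Prop :=
  forall i j : 'I_n, (i <= j)%N -> x 0 j <= x 0 i.

Section ConjDiag.
Context {R : realType} {n : nat}.
Implicit Types (U Q : 'M[R]_n) (x y v : 'rV[R]_n) (X Y V : symmx R n) (s : 'S_n).

Lemma conj_diagE U x i j : conj_diag U x i j = \sum_k U k i * x 0 k * U k j.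
Proof.
rewrite mxE; apply: eq_bigr => k _; congr (_ * _).
by rewrite mul_mx_diag !mxE.
Qed.

Lemma conj_diagD U x y : conj_diag U (x + y) = conj_diag U x + conj_diag U y.
Proof.
by apply/val_inj; rewrite /= linearD /= mulmxDr mulmxDl.
Qed.

Lemma conj_diagZ U a x : conj_diag U (a *: x) = a *: conj_diag U x.
Proof.
by apply/val_inj; rewrite /= linearZ /= -scalemxAr -scalemxAl.
Qed.

Lemma conj_diagB U x y : conj_diag U (x - y) = conj_diag U x - conj_diag U y.
Proof. by rewrite -scaleN1r conj_diagD conj_diagZ scaleN1r. Qed.

Lemma conj_diag_perm U s x :
  conj_diag (row_perm s U) (col_perm s x) = conj_diag U x.
Proof.
apply/val_inj/matrixP => i j; rewrite !conj_diagE.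
rewrite [RHS](reindex_inj (@perm_inj _ s)).
by apply: eq_bigr => k _; rewrite !mxE.
Qed.

Lemma orthogonal_row_perm U s : orthogonal_mx U -> orthogonal_mx (row_perm s U).
Proof.
move=> UU; rewrite /orthogonal_mx row_permE trmx_mul mulmxA -(mulmxA _ U) UU.
by rewrite mulmx1 tr_perm_mx -perm_mxM mulgV perm_mx1.
Qed.

Lemma orthogonal_sumr U i : orthogonal_mx U -> \sum_j U i j ^+ 2 = 1.
Proof.
move=> /matrixP/(_ i i); rewrite !mxE eqxx; apply: etrans.
by apply: eq_bigr => j _; rewrite mxE expr2.
Qed.

Lemma orthogonal_suml U j : orthogonal_mx U -> \sum_i U i j ^+ 2 = 1.
Proof.
move=> /orthogonal_mxV/matrixP/(_ j j); rewrite !mxE eqxx; apply: etrans.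
by apply: eq_bigr => i _; rewrite mxE expr2.
Qed.

(** The squared entries of [U *m Q^T] form a bistochastic matrix, which turns Fan's
    inequality into an assignment problem between the two spectra. *)
Lemma symdot_conj U Q x y : orthogonal_mx U -> orthogonal_mx Q ->
  symdot (conj_diag U x) (conj_diag Q y) =
  \sum_i \sum_j x 0 i * y 0 j * (U *m Q^T) i j ^+ 2.
Proof.
move=> UU QQ; set P := U *m Q^T.
have -> : symdot (conj_diag U x) (conj_diag Q y) =
    \tr (diag_mx x *m (P *m (diag_mx y *m P^T))).
  rewrite /symdot /= /P trmx_mul trmxK -!mulmxA mxtrace_mulC.
  by rewrite !mulmxA.
apply: eq_bigr => i _; rewrite mul_diag_mx mxE mxE mulr_sumr.
apply: eq_bigr => j _; rewrite mul_diag_mx !mxE; ring.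
Qed.

Lemma symdot_conj_same U x y : orthogonal_mx U ->
  symdot (conj_diag U x) (conj_diag U y) = rVdot x y.
Proof.
move=> UU; rewrite symdot_conj // UU; apply: eq_bigr => i _.
rewrite (bigD1 i) //= big1 => [|j ji]; rewrite !mxE.
  by rewrite eqxx expr1n mulr1 addr0.
by rewrite eq_sym (negPf ji) expr0n mulr0.
Qed.

Lemma ipnorm_conj U x : orthogonal_mx U ->
  ipnorm symdot (conj_diag U x) = ipnorm rVdot x.
Proof. by move=> UU; rewrite /ipnorm /= symdot_conj_same. Qed.

Lemma dist_conj U x y : orthogonal_mx U ->
  ipnorm symdot (conj_diag U x - conj_diag U y) = ipnorm rVdot (x - y).
Proof. by move=> UU; rewrite -conj_diagB ipnorm_conj. Qed.

Lemma conj_diag_comm U x y : orthogonal_mx U ->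
  (conj_diag U x : 'M[R]_n) *m conj_diag U y = conj_diag U y *m conj_diag U x.
Proof.
move=> UU; rewrite /= !mulmxA -!(mulmxA _ U) UU !mulmx1 -!(mulmxA U^T).
by rewrite diag_mxC.
Qed.

Lemma rVdot_perm s x y : rVdot (col_perm s x) (col_perm s y) = rVdot x y.
Proof.
rewrite [RHS](reindex_inj (@perm_inj _ s)).
by apply: eq_bigr => i _; rewrite !mxE.
Qed.

Lemma col_permB s x y : col_perm s (x - y) = col_perm s x - col_perm s y.
Proof. exact: linearB. Qed.

Lemma dist_perm s x y :
  ipnorm rVdot (col_perm s x - col_perm s y) = ipnorm rVdot (x - y).
Proof. by rewrite -col_permB /ipnorm /= rVdot_perm. Qed.

Lemma ipnorm_perm s x : ipnorm rVdot (col_perm s x) = ipnorm rVdot x.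
Proof. by rewrite /ipnorm /= rVdot_perm. Qed.

Lemma char_poly_conj U x : orthogonal_mx U ->
  char_poly (conj_diag U x) = \prod_i ('X - (x 0 i)%:P).
Proof.
move=> UU; transitivity (char_poly (diag_mx x)).
  rewrite /char_poly /char_poly_mx /=.
  have -> : 'X%:M - map_mx polyC (U^T *m diag_mx x *m U) =
      map_mx polyC U^T *m ('X%:M - map_mx polyC (diag_mx x)) *m map_mx polyC U.
    rewrite mulmxBr mulmxBl -!map_mxM /= scalar_mxC -(mulmxA 'X%:M) -map_mxM.
    by rewrite (orthogonal_mxV UU) map_mx1 mulmx1.
  rewrite !det_mulmx mulrAC -det_mulmx -map_mxM (orthogonal_mxV UU).
  by rewrite map_mx1 det1 mul1r.
rewrite char_poly_trig ?diag_mx_is_trig //.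
by apply: eq_bigr => i _; rewrite !mxE eqxx mulr1n.
Qed.

Lemma eq_prod_XsubC_perm x y :
  \prod_i ('X - (x 0 i)%:P) = \prod_i ('X - (y 0 i)%:P) ->
  exists s, y = col_perm s x.
Proof.
move=> xy; have : perm_eq [tuple y 0 i | i < n] [tuple x 0 i | i < n].
  apply: prod_XsubC_eq; rewrite /= !big_map -!enumT !big_enum /=.
  by rewrite xy.
move=> /tuple_permP[s sE]; exists s; apply/rowP => i.
have : tnth [tuple y 0 i | i < n] i =
    tnth [tuple tnth [tuple x 0 i | i < n] (s i) | i < n] i.
  by congr tnth; apply/val_inj.
by rewrite !tnth_mktuple mxE.
Qed.

Lemma nonincreasing_perm_eq x s :
  nonincreasing_row x ->
  nonincreasing_row (col_perm s x) ->
  col_perm s x = x.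
Proof.
move=> xs ys; set y := col_perm s x in ys *.
have sorted_row (z : 'rV[R]_n) :
    nonincreasing_row z ->
    sorted >=%R [tuple z 0 i | i < n].
  move=> zs; case: n z zs => [|m] z zs; first by rewrite tuple0.
  have zE k (km : (k < m.+1)%N) : [tuple z 0 i | i < m.+1]`_k = z 0 (Ordinal km).
    by rewrite -[RHS](tnth_mktuple (fun i => z 0 i)) (tnth_nth 0).
  apply/(sortedP 0) => i; rewrite size_tuple => im.
  by rewrite (zE _ im) (zE _ (ltnW im)); apply: zs => /=.
have : [tuple y 0 i | i < n] = [tuple x 0 i | i < n] :> seq R.
  apply: (sorted_eq ge_trans ge_anti); rewrite ?sorted_row //.
  by apply/tuple_permP; exists s; congr val; apply: eq_mktuple => i;
    rewrite tnth_mktuple mxE.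
move=> /val_inj/(congr1 (fun t => tnth t _)) yx; apply/rowP => i.
by have := yx i; rewrite !tnth_mktuple.
Qed.

Lemma lambda_noninc X : nonincreasing_row (lambda X).
Proof. by have [] := lambdaP X. Qed.

Lemma lambda_conj_perm U x : orthogonal_mx U ->
  exists s, lambda (conj_diag U x) = col_perm s x.
Proof.
move=> UU; apply: eq_prod_XsubC_perm; rewrite -(char_poly_conj x UU).
by have [_ ->] := lambdaP (conj_diag U x).
Qed.

Lemma lambda_conj U x : orthogonal_mx U ->
  nonincreasing_row x ->
  lambda (conj_diag U x) = x.
Proof.
move=> UU xs; have [s sE] := lambda_conj_perm x UU.
by rewrite sE nonincreasing_perm_eq // -sE; exact: lambda_noninc.
Qed.

Lemma lambda_conj_lambda U X : orthogonal_mx U ->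
  lambda (conj_diag U (lambda X)) = lambda X.
Proof. by move=> UU; apply: lambda_conj => //; exact: lambda_noninc. Qed.

(** The common eigenbasis can be ordered by the eigenvalues of [X], so that it is
    one of the matrices [U] with [X = U^T Diag(lambda X) U]. *)
Lemma joint_diagonalizer X V : (X : 'M[R]_n) *m V = (V : 'M[R]_n) *m X ->
  exists U, diagonalizers X U /\ exists v, V = conj_diag U v.
Proof.
move=> XV; have symT (Y : symmx R n) : (Y : 'M[R]_n)^T = Y.
  by have := symmxP Y; rewrite symmetricmxE => /eqP <-.
have [Q [QQ QX QV]] := joint_diagonalization (symT X) (symT V) XV.
have diagE Y : is_diag_mx (Q *m Y *m Q^T) -> exists d, Y = conj_diag Q d.
  move=> /is_diag_mxP dY; exists (\row_i (Q *m Y *m Q^T) i i).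
  apply/val_inj => /=.
  have -> : diag_mx (\row_i (Q *m Y *m Q^T) i i) = Q *m Y *m Q^T.
    apply/matrixP => i j; rewrite mxE mxE.
    have [->|ij] := eqVneq i j; first by rewrite mulr1n.
    by rewrite mulr0n dY.
  rewrite !mulmxA (orthogonal_mxV QQ) mul1mx -mulmxA (orthogonal_mxV QQ).
  by rewrite mulmx1.
have [x xE] := diagE X QX; have [v vE] := diagE V QV.
have [s sE] := lambda_conj_perm x QQ.
exists (row_perm s Q); split; first split.
- exact: orthogonal_row_perm.
- by rewrite xE sE conj_diag_perm.
- by exists (col_perm s v); rewrite conj_diag_perm.
Qed.

Lemma diagonalizerP X : exists U, diagonalizers X U.
Proof. by have [//|U [XU _]] := @joint_diagonalizer X X; exists U. Qed.

(** [a i * b i - q i] and [q j] are dual feasible for the assignment problem with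
    reward [a i * b j]: the increments of [j |-> a i * b j - q j] are
    [(a i - a j) * (b (j + 1) - b j)], nonnegative before [i] and nonpositive
    after it, so that the maximum is reached at [j = i]. *)
Lemma assignment_potential (a b q : nat -> R) :
  {homo a : i j / (i <= j)%N >-> j <= i} ->
  {homo b : i j / (i <= j)%N >-> j <= i} ->
  (forall k, q k.+1 - q k = a k * (b k.+1 - b k)) ->
  forall i j, a i * b j <= a i * b i - q i + q j.
Proof.
move=> aN bN qE i j.
suff : a i * (b j - b i) <= q j - q i by lra.
have bD k : b k.+1 - b k <= 0 by rewrite subr_le0 bN.
have [ij|/ltnW ji] := leqP i j.
  rewrite -!(telescope_sumr _ ij) mulr_sumr; apply: ler_sum_nat => k /andP[ik _].
  by rewrite qE ler_wnM2r // aN.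
rewrite -[b j - b i]opprB -[q j - q i]opprB mulrN lerN2.
rewrite -!(telescope_sumr _ ji) mulr_sumr; apply: ler_sum_nat => k /andP[_ ki].
by rewrite qE ler_wnM2r // aN // ltnW.
Qed.

(** Weak duality: averaging [x i * y j <= p i + q j] against a bistochastic matrix
    leaves the total of the potentials, and [p i + q i = x i * y i] makes this
    total [<x, y>]. This avoids writing the matrix as an average of
    permutations. *)
Lemma rearrangement_bistochastic x y (S : 'M[R]_n) :
  nonincreasing_row x ->
  nonincreasing_row y ->
  (forall i j, 0 <= S i j) ->
  (forall i, \sum_j S i j = 1) -> (forall j, \sum_i S i j = 1) ->
  \sum_i \sum_j x 0 i * y 0 j * S i j <= rVdot x y.
Proof.
move=> xs ys S0 Sr Sl.
suff [p [q [pq pqE]]] : exists p q : 'I_n -> R,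
    (forall i j, x 0 i * y 0 j <= p i + q j) /\
    (forall i, p i + q i = x 0 i * y 0 i).
  apply: (@le_trans _ _ (\sum_i \sum_j (p i + q j) * S i j)).
    by apply: ler_sum => i _; apply: ler_sum => j _; rewrite ler_wpM2r.
  have -> : \sum_i \sum_j (p i + q j) * S i j =
      \sum_i \sum_j p i * S i j + \sum_i \sum_j q j * S i j.
    rewrite -big_split; apply: eq_bigr => i _.
    by rewrite -big_split; apply: eq_bigr => j _; rewrite mulrDl.
  rewrite [X in _ + X]exchange_big -big_split /=.
  apply: ler_sum => i _; rewrite -!mulr_sumr Sr Sl !mulr1.
  by rewrite pqE.
case: n x y xs ys {S S0 Sr Sl} => [|m] x y xs ys.
  by exists (fun=> 0), (fun=> 0); split=> [[]|[]].
(* Rows are continued by their last entry, which keeps them nonincreasing. *)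
pose ext (z : 'rV[R]_m.+1) k := z 0 (inord (minn k m)).
have extN (z : 'rV[R]_m.+1) :
    nonincreasing_row z ->
    {homo ext z : i j / (i <= j)%N >-> j <= i}.
  move=> zs i j ij; apply: zs; rewrite !inordK ?ltnS ?geq_minr //.
  by rewrite leq_min geq_minr andbT (leq_trans (geq_minl _ _)).
have extE (z : 'rV[R]_m.+1) (i : 'I_m.+1) : ext z i = z 0 i.
  by congr (z 0 _); apply/val_inj; rewrite /= (minn_idPl _) ?inordK // -ltnS.
pose q j := \sum_(0 <= k < j) ext x k * (ext y k.+1 - ext y k).
have qE k : q k.+1 - q k = ext x k * (ext y k.+1 - ext y k).
  by rewrite /q big_nat_recr //= addrAC subrr add0r.
exists (fun i => x 0 i * y 0 i - q i), q; split=> [i j|i]; last by rewrite subrK.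
by have := assignment_potential (extN x xs) (extN y ys) qE i j; rewrite !extE.
Qed.

(** In eigenbases of [X] and [Y] the left-hand side pairs the two spectra with
    bistochastic weights. *)
Lemma symdot_le_lambda X Y : symdot X Y <= rVdot (lambda X) (lambda Y).
Proof.
have [U [UU XE]] := diagonalizerP X; have [Q [QQ YE]] := diagonalizerP Y.
rewrite {1}XE {1}YE symdot_conj //.
have UQ : orthogonal_mx (U *m Q^T).
  by apply: orthogonal_mxM => //; rewrite /orthogonal_mx trmxK orthogonal_mxV.
have := @rearrangement_bistochastic (lambda X) (lambda Y)
  (\matrix_(i, j) (U *m Q^T) i j ^+ 2).
move=> /(_ (lambda_noninc X) (lambda_noninc Y)) h.
rewrite (eq_bigr (fun i => \sum_j lambda X 0 i * lambda Y 0 j *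
    (\matrix_(i, j) (U *m Q^T) i j ^+ 2) i j)); last first.
  by move=> i _; apply: eq_bigr => j _; rewrite mxE.
apply: h => [i j|i|j]; first by rewrite mxE sqr_ge0.
  by rewrite -[RHS](orthogonal_sumr i UQ); apply: eq_bigr => j _; rewrite mxE.
by rewrite -[RHS](orthogonal_suml j UQ); apply: eq_bigr => i _; rewrite mxE.
Qed.

Lemma ipnorm_lambda X : ipnorm rVdot (lambda X) = ipnorm symdot X.
Proof. by have [U [UU {2}->]] := diagonalizerP X; rewrite ipnorm_conj. Qed.

(** The squared norms on both sides agree, so that this is Fan's inequality for the
    cross terms. *)
Lemma dist_lambda X Y :
  ipnorm rVdot (lambda X - lambda Y) <= ipnorm symdot (X - Y).
Proof.
rewrite -(ler_pXn2r (n := 2)) ?nnegrE ?ipnorm_ge0 // !sqr_ipnorm !ipBB.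
rewrite -!sqr_ipnorm !ipnorm_lambda /=.
by have := symdot_le_lambda X Y; lra.
Qed.

End ConjDiag.

(** * Limits of commuting pairs *)

Section Commutation.
Context {R : realType} {n : nat}.
Implicit Types (x y v w : 'rV[R]_n) (X Y V W : symmx R n) (s : 'S_n).

Lemma symdotE X : symdot X X = \sum_i \sum_j X i j ^+ 2.
Proof.
apply: eq_bigr => i _; rewrite mxE; apply: eq_bigr => j _.
have := symmxP X; rewrite symmetricmxE => /eqP XT.
by rewrite expr2 [in X in _ * X = _]XT mxE.
Qed.

Lemma entry_le_ipnorm X i j : `|X i j| <= ipnorm symdot X.
Proof.
rewrite -(ler_pXn2r (n := 2)) ?nnegrE ?ipnorm_ge0 // sqr_ipnorm /= symdotE.
rewrite real_normK ?num_real // (bigD1 i) //= (bigD1 j) //= -addrA lerDl.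
rewrite addr_ge0 ?sumr_ge0 // => k _; rewrite ?sqr_ge0 // sumr_ge0 // => m _.
exact: sqr_ge0.
Qed.

Lemma mul_entry_le X Y i j :
  `|((X : 'M[R]_n) *m Y) i j| <= n%:R * (ipnorm symdot X * ipnorm symdot Y).
Proof.
rewrite mxE; apply: le_trans (ler_norm_sum _ _ _) _.
rewrite -[n in n%:R](card_ord n) -sum1_card natr_sum mulr_suml.
apply: ler_sum => k _; rewrite mul1r normrM.
by rewrite ler_pM // entry_le_ipnorm.
Qed.

Lemma small_factor (c e : R) : 0 < e -> exists2 t, 0 < t & t * c < e.
Proof.
move=> e0; exists (e / (`|c| + 1)); first by rewrite divr_gt0 // ltr_wpDl.
have c1 : 0 < `|c| + 1 by rewrite ltr_wpDl.
rewrite -mulrA -ltr_pdivlMl // mulVf ?gt_eqF // mulrC ltr_pdivrMr // mul1r.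
by apply: le_lt_trans (ler_norm c) _; rewrite ltrDl.
Qed.

(** Commuting pairs are a closed set, by continuity of the commutator. *)
Lemma commute_closed X V :
  (forall eps, 0 < eps -> exists Y W, [/\ (Y : 'M[R]_n) *m W = (W : 'M[R]_n) *m Y,
    ipnorm symdot (Y - X) < eps & ipnorm symdot (W - V) < eps]) ->
  (X : 'M[R]_n) *m V = (V : 'M[R]_n) *m X.
Proof.
move=> approx; apply/matrixP => i j; apply/eqP; rewrite -subr_eq0 -normr_le0.
apply/ler_addgt0Pr => e e0; rewrite add0r; apply: ltW.
pose c := ipnorm symdot X + ipnorm symdot V + 1.
have [t t0 te] := small_factor (n%:R * c * 2) e0.
pose d := Num.min t 1.
have d0 : 0 < d by rewrite lt_min t0 ltr01.
have [Y [W [YW YX WV]]] := approx _ d0.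
pose D := Y - X; pose F := W - V.
have XVE : (X : 'M[R]_n) *m V - (V : 'M[R]_n) *m X =
    (F : 'M[R]_n) *m Y + (V : 'M[R]_n) *m D
    - ((D : 'M[R]_n) *m W + (X : 'M[R]_n) *m F).
  have -> : symmx_val D = (Y : 'M[R]_n) - X by [].
  have -> : symmx_val F = (W : 'M[R]_n) - V by [].
  rewrite !mulmxBl !mulmxBr !subrKA YW opprB.
  by rewrite [RHS]addrC subrKA.
have -> : ((X : 'M[R]_n) *m V) i j - ((V : 'M[R]_n) *m X) i j =
    ((X : 'M[R]_n) *m V - (V : 'M[R]_n) *m X) i j
  by rewrite [RHS]mxE [X in _ = _ + X]mxE.
have YX1 : ipnorm symdot Y <= ipnorm symdot X + 1.
  rewrite -[Y](subrK X) addrC (le_trans (ipnorm_triangle _ _ _)) // lerD2l.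
  by rewrite (le_trans (ltW YX)) // ge_min lexx orbT.
have WV1 : ipnorm symdot W <= ipnorm symdot V + 1.
  rewrite -[W](subrK V) addrC (le_trans (ipnorm_triangle _ _ _)) // lerD2l.
  by rewrite (le_trans (ltW WV)) // ge_min lexx orbT.
have bnd (A B : symmx R n) a b : ipnorm symdot A <= a -> ipnorm symdot B <= b ->
    `|((A : 'M[R]_n) *m B) i j| <= n%:R * (a * b).
  move=> Aa Bb; apply: le_trans (mul_entry_le _ _ _ _) _.
  by rewrite ler_wpM2l ?ler0n // ler_pM ?ipnorm_ge0.
have FY := bnd _ _ _ _ (ltW WV) YX1.
have VD := bnd _ _ _ _ (lexx (ipnorm symdot V)) (ltW YX).
have DW := bnd _ _ _ _ (ltW YX) WV1.
have XF := bnd _ _ _ _ (lexx (ipnorm symdot X)) (ltW WV).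
rewrite XVE [X in `|X|]mxE [X in X + _]mxE [X in _ + X]mxE [X in _ - X]mxE.
apply: le_lt_trans te.
have dt : d * (n%:R * c * 2) <= t * (n%:R * c * 2).
  rewrite ler_wpM2r ?ge_min ?lexx // !mulr_ge0 ?ler0n //.
  by rewrite !addr_ge0 ?ipnorm_ge0.
apply: le_trans dt; apply: le_trans (ler_normB _ _) _.
apply: le_trans (lerD (ler_normD _ _) (ler_normD _ _)) _.
apply: le_trans (lerD (lerD FY VD) (lerD DW XF)) _.
by rewrite le_eqVlt; apply/orP; left; apply/eqP; rewrite /c; ring.
Qed.

End Commutation.

(** * Permutations and joint spectra near a given point *)

Section PermRadius.
Context {R : realType} {n : nat}.
Implicit Types (x y v w : 'rV[R]_n) (X Y V W : symmx R n)
  (U Q : 'M[R]_n) (s : 'S_n).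

Lemma exists_perm_dist U Q x y : orthogonal_mx U -> orthogonal_mx Q ->
  exists s, ipnorm rVdot (col_perm s x - y) <=
    ipnorm symdot (conj_diag U x - conj_diag Q y).
Proof.
move=> UU QQ; have [s sE] := lambda_conj_perm x UU.
have [t tE] := lambda_conj_perm y QQ.
exists (t^-1 * s)%g; rewrite -(dist_perm t) -col_permM mulKVg -sE -tE.
exact: dist_lambda.
Qed.

(** Half the distance from [x] to its nearest distinct permutation, or less. Within
    this radius a permutation that keeps a point near [x] must fix [x]. *)
Definition perm_radius x (r : R) : Prop := 0 < r /\
  forall s, ipnorm rVdot (col_perm s x - x) < 2 * r -> fixing_perms x s.

Lemma perm_radius_exists x : exists r, perm_radius x r.
Proof.
pose m := \big[Num.min/1]_(s | col_perm s x != x) ipnorm rVdot (col_perm s x - x).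
have m0 : 0 < m.
  apply: lt_bigmin => [|s sx]; first exact: ltr01.
  rewrite lt_neqAle ipnorm_ge0 andbT eq_sym; apply: contraNneq sx => /ipnorm_eq0.
  by move/eqP; rewrite subr_eq0.
exists (m / 2); split=> [|s]; first by rewrite divr_gt0.
rewrite mulrCA divff // mulr1 => sm.
apply/eqP; apply: contraTT sm => sx; rewrite -leNgt.
exact: bigmin_le_cond.
Qed.

Lemma fixing_perms_sort x r y s :
  perm_radius x r -> ipnorm rVdot (y - x) < r ->
  ipnorm rVdot (col_perm s y - x) < r -> fixing_perms x s.
Proof.
move=> [r0 rx] yx sx; apply: rx.
apply: le_lt_trans (ipnorm_dist _ _ (col_perm s y) _) _.
by rewrite dist_perm (ipnormBC _ x) mulr_natl mulr2n ltrD //.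
Qed.

Lemma fixing_perms_near x r y s : perm_radius x r -> ipnorm rVdot (y - x) < r ->
  fixing_perms y s -> fixing_perms x s.
Proof.
move=> xr yx ys; apply: (fixing_perms_sort xr yx).
by rewrite (ys : col_perm s y = y).
Qed.

(** Sorting a point near a sorted [x] only needs permutations fixing [x], as [lambda]
    is 1-Lipschitz. *)
Lemma lambda_conj_near x r y U : orthogonal_mx U ->
  nonincreasing_row x ->
  perm_radius x r -> ipnorm rVdot (y - x) < r ->
  exists2 s, fixing_perms x s & lambda (conj_diag U y) = col_perm s y.
Proof.
move=> UU xs xr yx; have [s sE] := lambda_conj_perm y UU; exists s => //.
apply: (fixing_perms_sort xr yx); rewrite -sE -(lambda_conj UU xs).
by apply: le_lt_trans (dist_lambda _ _) _; rewrite dist_conj.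
Qed.

(** Up to a permutation [s], the spectra [lambda Y + t w] and [lambda X + t v] of
    [Y + t W] and [X + t V] are close. When [t] is small compared with the
    distances between the permutations of [lambda X], this forces [s] to fix
    [lambda X]; the closeness then transfers to [w] and [v]. *)
Lemma joint_spectrum_near X U v eps : diagonalizers X U -> 0 < eps ->
  exists2 delta, 0 < delta & forall Y Q w, diagonalizers Y Q ->
    ipnorm symdot (Y - X) < delta ->
    ipnorm symdot (conj_diag Q w - conj_diag U v) < delta ->
    exists2 s, fixing_perms (lambda X) s & ipnorm rVdot (col_perm s w - v) < eps.
Proof.
move=> [UU XE] e0; have [r [r0 rX]] := perm_radius_exists (lambda X).
have [t t0 tr] := small_factor (2 * ipnorm rVdot v) r0.
(* The first bound is for the final estimate, the second one is what remains of
   the allowance [2 * r] for moving [lambda X] once [2 * t * |v| < r] is spent. *)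
pose delta := Num.min (t * eps / (2 + t)) (r / (2 + 2 * t)).
have d0 : 0 < delta by rewrite lt_min !divr_gt0 ?mulr_gt0 ?addr_gt0 ?mulr_gt0.
exists delta => // Y Q w [QQ YE] YX; set W := conj_diag Q w; set V := conj_diag U v.
move=> WV.
have d1 : (2 + t) * delta <= t * eps.
  by rewrite mulrC -ler_pdivlMr ?addr_gt0 // ge_min lexx.
have d2 : (2 + 2 * t) * delta <= r.
  by rewrite mulrC -ler_pdivlMr ?addr_gt0 ?mulr_gt0 // ge_min lexx orbT.
have [s] := exists_perm_dist (lambda Y + t *: w) (lambda X + t *: v) QQ UU.
rewrite !conj_diagD !conj_diagZ -XE -YE -/W -/V => sE.
have YtW : ipnorm symdot (Y + t *: W - (X + t *: V)) < delta + t * delta.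
  rewrite opprD addrACA -scalerBr; apply: le_lt_trans (ipnorm_triangle _ _ _) _.
  by rewrite ipnormZ gtr0_norm // ltrD // ltr_pM2l.
have {sE} {}YtW := le_lt_trans sE YtW.
have lYX := le_lt_trans (dist_lambda Y X) YX.
have combined : ipnorm rVdot ((col_perm s (lambda X) - lambda X)
    + t *: (col_perm s w - v)) < (2 + t) * delta.
  rewrite (_ : _ + _ = (col_perm s (lambda X) - col_perm s (lambda Y)) +
      (col_perm s (lambda Y + t *: w) - (lambda X + t *: v))); last first.
    by apply/rowP => i; rewrite !mxE; ring.
  apply: le_lt_trans (ipnorm_triangle _ _ _) _.
  rewrite dist_perm (ipnormBC _ _ (lambda Y)).
  by rewrite (_ : (2 + t) * delta = delta + (delta + t * delta)) ?ltrD //; ring.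
have wv : ipnorm rVdot w < ipnorm rVdot v + delta.
  rewrite -(ipnorm_conj w QQ) -(ipnorm_conj v UU) -/W -/V addrC -[W](subrK V).
  by apply: le_lt_trans (ipnorm_triangle _ _ _) _; rewrite ltrD2r.
have sX : fixing_perms (lambda X) s.
  apply: rX; rewrite -[_ - _](addrK (t *: (col_perm s w - v))).
  apply: le_lt_trans (ipnorm_triangle _ _ _) _; rewrite ipnormN ipnormZ gtr0_norm //.
  have : t * ipnorm rVdot (col_perm s w - v) <=
      t * (ipnorm rVdot v + delta + ipnorm rVdot v).
    rewrite ler_pM2l // (le_trans (ipnorm_triangle _ _ _)) // ipnormN ipnorm_perm.
    by rewrite lerD2r ltW.
  by move: combined d2 tr; clear; lra.
exists s => //; move: combined; rewrite [col_perm s (lambda X)]sX subrr add0r.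
rewrite ipnormZ gtr0_norm // => /lt_le_trans/(_ d1).
by rewrite ltr_pM2l.
Qed.

(** The permutations are chosen among those fixing [lambda X] so as to bring [ws i]
    closest to [v], which makes one choice serve every precision. *)
Lemma joint_spectrum_cvg X U v (Xs : nat -> symmx R n) Qs ws :
  diagonalizers X U -> (forall i, diagonalizers (Xs i) (Qs i)) ->
  ipcvg symdot Xs X ->
  ipcvg symdot (fun i => conj_diag (Qs i) (ws i)) (conj_diag U v) ->
  exists ss : nat -> 'S_n, [/\ forall i, fixing_perms (lambda X) (ss i),
    ipcvg rVdot (fun i => col_perm (ss i) (lambda (Xs i))) (lambda X)
    & ipcvg rVdot (fun i => col_perm (ss i) (ws i)) v].
Proof.
move=> XU XQ /ipcvgP XsX /ipcvgP WsV.
pose fixes s := col_perm s (lambda X) == lambda X.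
have fixes1 : fixes 1%g by rewrite /fixes col_perm1.
pose ss i := [arg min_(s < 1%g | fixes s) ipnorm rVdot (col_perm s (ws i) - v)]%O.
have ssP i : fixing_perms (lambda X) (ss i) /\ forall s, fixing_perms (lambda X) s ->
    ipnorm rVdot (col_perm (ss i) (ws i) - v) <=
      ipnorm rVdot (col_perm s (ws i) - v).
  rewrite /ss; case: arg_minP => // s /eqP sX smin; split=> // u /eqP.
  exact: smin.
exists ss; split=> [i||]; first by have [] := ssP i.
  apply/ipcvgP => eps e0; have := XsX _ e0; apply: filterS => i Xi.
  have [sX _] := ssP i; rewrite -[in X in _ - X]sX dist_perm.
  exact: le_lt_trans (dist_lambda _ _) _.
apply/ipcvgP => eps e0; have [d d0 dP] := joint_spectrum_near v XU e0.
have := WsV _ d0; have := XsX _ d0; apply: filterS2 => i Xi Wi.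
have [s sX sw] := dP _ _ _ (XQ i) Xi Wi.
by have [_ smin] := ssP i; apply: le_lt_trans (smin s sX) sw.
Qed.

End PermRadius.

(** * Subgradients of spectral functions *)

Section CommuteSpectral.
Context {R : realType} {n : nat}.
Implicit Types (X Y V W : symmx R n).

(** [Y], obtained from [X + t V] by replacing its spectrum with that of [X], is the
    projection of [X + t V] on the matrices with the spectrum of [X]. Since it
    commutes with [X + t V] and [|Y - X| = o(t)], the pair [Y],
    [(X + t V - Y) / t] commutes and is as close as desired to [X], [V]. *)
Lemma frechet_spectral_comm (g : symmx R n -> \bar R) X V :
  (forall Y, lambda Y = lambda X -> g Y = g X) ->
  frechet_subdiff symdot g X V -> (X : 'M[R]_n) *m V = (V : 'M[R]_n) *m X.
Proof.
move=> gX [gXfin gV]; apply: commute_closed => eps e0.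
have e40 : 0 < eps / 4 by rewrite divr_gt0.
have [d d0 dP] := gV _ e40.
have dm0 : 0 < Num.min d eps by rewrite lt_min d0.
have [t0 t00 t0V] := small_factor (2 * ipnorm symdot V) dm0.
pose t := Num.min t0 1; have t_gt0 : 0 < t by rewrite lt_min t00 ltr01.
have tV : 2 * t * ipnorm symdot V < Num.min d eps.
  apply: le_lt_trans t0V; rewrite mulrAC mulrC ler_wpM2r ?mulr_ge0 ?ipnorm_ge0 //.
  by rewrite ge_min lexx.
pose A := X + t *: V; have AXV : A = X + t *: V by [].
clearbody A; have [Q [QQ AE]] := diagonalizerP A.
pose Y := conj_diag Q (lambda X); have YE : Y = conj_diag Q (lambda X) by [].
clearbody Y; pose N := ipnorm symdot (Y - X).
have lY : lambda Y = lambda X by rewrite YE lambda_conj_lambda.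
have YA : (Y : 'M[R]_n) *m A = (A : 'M[R]_n) *m Y.
  by have := conj_diag_comm (lambda X) (lambda A) QQ; rewrite -YE -AE.
(* [Y] is at least as close to [A] as [X] is, by Fan's inequality. *)
have NE : N ^+ 2 <= 2 * t * symdot V (Y - X).
  have YAX : symdot X A <= symdot Y A.
    by rewrite YE [in leRHS]AE symdot_conj_same // symdot_le_lambda.
  have YY : symdot Y Y = symdot X X.
    by rewrite -!(sqr_ipnorm symdot) -(ipnorm_lambda Y) lY ipnorm_lambda.
  rewrite sqr_ipnorm ipBB ipBr /= YY (ipC _ V Y) (ipC _ V X) (ipC _ Y X) /=.
  move: YAX; rewrite AXV !ipDr !ipZr /= (ipC _ Y X) /=.
  by clear; lra.
have N0 : 0 <= N by exact: ipnorm_ge0.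
have N_le a : 0 <= a -> symdot V (Y - X) <= a * N -> N <= 2 * t * a.
  move=> a0 VY; have [->|Nn0] := eqVneq N 0.
    by rewrite !mulr_ge0 // ltW.
  have Npos : 0 < N by rewrite lt_def Nn0.
  rewrite -(ler_pM2r Npos) -expr2 -[_ * a * N]mulrA; apply: le_trans NE _.
  by apply: ler_wpM2l => //; rewrite mulr_ge0 // ltW.
have NV : N <= 2 * t * ipnorm symdot V.
  by apply: N_le; [exact: ipnorm_ge0|exact: CauchySchwarz_ip].
have [Nd Neps] : N < d /\ N < eps.
  by have := le_lt_trans NV tV; rewrite lt_min => /andP[].
have {}N_le : N <= 2 * t * (eps / 4).
  apply: (N_le _ (ltW e40)); have := dP Y Nd; rewrite gX // -/N.
  by rewrite -[leRHS]adde0 leeD2lE // lee_fin subr_le0.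
exists Y, (t^-1 *: (A - Y)); split=> //.
  have -> : symmx_val (t^-1 *: (A - Y)) = t^-1 *: ((A : 'M[R]_n) - Y) by [].
  by rewrite -scalemxAr -scalemxAl mulmxBl mulmxBr YA.
have -> : t^-1 *: (A - Y) - V = - t^-1 *: (Y - X).
  rewrite AXV scaleNr -scalerN opprB addrAC scalerDr scalerA.
  by rewrite mulVf ?gt_eqF // scale1r addrK.
rewrite ipnormZ normrN gtr0_norm ?invr_gt0 // -/N mulrC ltr_pdivrMr //.
by apply: le_lt_trans N_le _; have := mulr_gt0 e0 t_gt0; clear; lra.
Qed.

End CommuteSpectral.

Section LocallySymmetric.
Context {R : realType} {n : nat} (f : 'rV[R]_n -> \bar R).
Implicit Types (x y v w : 'rV[R]_n) (X Y V W : symmx R n)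
  (U Q : 'M[R]_n) (s : 'S_n).
Variables (xbar : 'rV[R]_n) (r : R).
Hypothesis xbar_r : perm_radius xbar r.
Hypothesis xbar_noninc : nonincreasing_row xbar.
Hypothesis f_sym : forall y, ipnorm rVdot (y - xbar) < r ->
  forall s, fixing_perms xbar s -> f (col_perm s y) = f y.

Lemma lambda_conj_value U y : orthogonal_mx U -> ipnorm rVdot (y - xbar) < r ->
  f (lambda (conj_diag U y)) = f y.
Proof.
move=> UU yr; have [s sx ->] := lambda_conj_near UU xbar_noninc xbar_r yr.
exact: f_sym.
Qed.

Lemma dist_fixed s x : fixing_perms xbar s ->
  ipnorm rVdot (col_perm s x - xbar) = ipnorm rVdot (x - xbar).
Proof. by move=> sx; rewrite -[in LHS](sx : col_perm s xbar = xbar) dist_perm. Qed.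

Lemma frechet_perm s x v : ipnorm rVdot (x - xbar) < r -> fixing_perms xbar s ->
  frechet_subdiff rVdot f x v ->
  frechet_subdiff rVdot f (col_perm s x) (col_perm s v).
Proof.
move=> xr sx [fx fv]; split=> [|eps e0]; first by rewrite f_sym.
have [d d0 dP] := fv _ e0.
exists (Num.min d (r - ipnorm rVdot (x - xbar))).
  by rewrite lt_min d0 subr_gt0.
move=> y; have -> : y = col_perm s (col_perm s^-1 y).
  by rewrite -col_permM mulgV col_perm1.
set z := col_perm _ y; rewrite dist_perm -col_permB /= rVdot_perm.
rewrite lt_min ltrBrDr => /andP[zd zr].
have {}zr : ipnorm rVdot (z - xbar) < r.
  exact: le_lt_trans (ipnorm_dist _ _ x _) zr.
by rewrite (f_sym zr sx) (f_sym xr sx); exact: dP.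
Qed.

(** Adding [t v] to [x] breaks the ties of [x], so that Fan's inequality becomes
    sensitive to [v]. The error it makes on [x] itself is of second order:
    [2 (<x, lambda Y> - <X, Y>) = |Y - X|^2 - |lambda Y - x|^2]. *)
Lemma frechet_lambda_sorted x v U : orthogonal_mx U ->
  ipnorm rVdot (x - xbar) < r ->
  nonincreasing_row x ->
  frechet_subdiff rVdot f x v ->
  frechet_subdiff symdot (f \o lambda) (conj_diag U x) (conj_diag U v).
Proof.
move=> UU xr xs fv.
have lX := lambda_conj UU xs.
split=> [|eps e0]; first by rewrite /= lX; have [] := fv.
have [rx rxP] := perm_radius_exists x; have rx0 := rxP.1.
have [t t0 tv] := small_factor (ipnorm rVdot v) rx0.
have xtv : ipnorm rVdot (x + t *: v - x) < rx.
  by rewrite addrAC subrr add0r ipnormZ gtr0_norm.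
have [s sx sE] := lambda_conj_near UU xs rxP xtv.
have fv' : frechet_subdiff rVdot f x (col_perm s v).
  rewrite -(sx : col_perm s x = x); apply: frechet_perm => //.
  exact: fixing_perms_near xbar_r xr sx.
set X := conj_diag U x in lX *; set V := conj_diag U v.
have e20 : 0 < eps / 2 by rewrite divr_gt0.
have [d d0 dP] := fv'.2 _ e20.
(* Half of [eps] pays for the error term of [f]; within [t * eps] the other half
   pays for the second-order error divided by [t]. *)
exists (Num.min d (t * eps)) => [|Y]; first by rewrite lt_min d0 mulr_gt0.
rewrite lt_min => /andP[Yd Yt]; rewrite /= lX.
have lYX : ipnorm rVdot (lambda Y - x) <= ipnorm symdot (Y - X).
  by rewrite -[in leLHS]lX dist_lambda.
apply: le_trans (dP _ (le_lt_trans lYX Yd)).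
rewrite leeD2l // lee_fin.
have N0 := ipnorm_ge0 symdot (Y - X).
have NE := sqr_ipnorm symdot (Y - X); rewrite ipBB /= in NE.
have YY := sqr_ipnorm symdot Y; rewrite /= -ipnorm_lambda sqr_ipnorm /= in YY.
have l0 := ip_ge0 rVdot (lambda Y - x); rewrite ipBB /= in l0.
have XX : symdot X X = rVdot x x by rewrite symdot_conj_same.
have VX : symdot V X = rVdot v x by rewrite symdot_conj_same.
have vx : rVdot (col_perm s v) x = rVdot v x.
  by rewrite -[in LHS](sx : col_perm s x = x) rVdot_perm.
have fan := symdot_le_lambda (conj_diag U (x + t *: v)) Y.
have {sE} sE : lambda (conj_diag U (x + t *: v)) = x + t *: col_perm s v.
  by rewrite sE -[in RHS](sx : col_perm s x = x); apply/rowP => i; rewrite !mxE.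
rewrite sE conj_diagD conj_diagZ -/X -/V !ipDl !ipZl /= in fan.
rewrite (ipC _ X Y) (ipC _ x) /= in fan.
have NN : ipnorm symdot (Y - X) ^+ 2 <= t * eps * ipnorm symdot (Y - X).
  by rewrite expr2 ler_wpM2r // ltW.
have tL : t * eps * ipnorm rVdot (lambda Y - x) <= t * eps * ipnorm symdot (Y - X).
  by rewrite ler_wpM2l // mulr_ge0 ?ltW.
rewrite !ipBr /= vx VX -(ler_pM2l t0).
by move: fan NN tL NE l0; rewrite XX YY; clear; lra.
Qed.

Lemma frechet_lambda x v U : orthogonal_mx U -> ipnorm rVdot (x - xbar) < r ->
  frechet_subdiff rVdot f x v ->
  frechet_subdiff symdot (f \o lambda) (conj_diag U x) (conj_diag U v).
Proof.
move=> UU xr fv; have [s sx sE] := lambda_conj_near UU xbar_noninc xbar_r xr.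
rewrite -(conj_diag_perm U s x) -(conj_diag_perm U s v).
apply: frechet_lambda_sorted; first exact: orthogonal_row_perm.
- by rewrite dist_fixed.
- by move=> i j ij; rewrite -sE lambda_noninc.
- exact: frechet_perm.
Qed.

(** On the matrices diagonalized by [U], the function [f \o lambda] is a copy of [f],
    isometrically. *)
Lemma frechet_lambda_diag X U v : diagonalizers X U ->
  ipnorm rVdot (lambda X - xbar) < r ->
  frechet_subdiff symdot (f \o lambda) X (conj_diag U v) ->
  frechet_subdiff rVdot f (lambda X) v.
Proof.
move=> [UU XE] Xr [fX fV]; split=> // eps e0; have [d d0 dP] := fV _ e0.
exists (Num.min d (r - ipnorm rVdot (lambda X - xbar))).
  by rewrite lt_min d0 subr_gt0.
move=> y; rewrite lt_min ltrBrDr => /andP[yd yr].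
have {}yr : ipnorm rVdot (y - xbar) < r.
  exact: le_lt_trans (ipnorm_dist _ _ (lambda X) _) yr.
have YX : conj_diag U y - X = conj_diag U (y - lambda X).
  by rewrite conj_diagB -XE.
have := dP (conj_diag U y).
by rewrite YX /= ipnorm_conj // symdot_conj_same // lambda_conj_value //; apply.
Qed.

Lemma frechet_lambda_inv X V : ipnorm rVdot (lambda X - xbar) < r ->
  frechet_subdiff symdot (f \o lambda) X V ->
  exists U v, [/\ diagonalizers X U, V = conj_diag U v
    & frechet_subdiff rVdot f (lambda X) v].
Proof.
move=> Xr fV; have XV : (X : 'M[R]_n) *m V = (V : 'M[R]_n) *m X.
  by apply: frechet_spectral_comm fV => Y /= ->.
have [U [XU [v vE]]] := joint_diagonalizer XV; exists U, v; split=> //.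
by apply: frechet_lambda_diag XU Xr _; rewrite -vE.
Qed.

End LocallySymmetric.

Section Limiting.
Context {R : realType} {n : nat} (f : 'rV[R]_n -> \bar R).
Implicit Types (x y v w : 'rV[R]_n) (X Y V W : symmx R n)
  (U Q : 'M[R]_n) (s : 'S_n).
Variables (xbar : 'rV[R]_n) (r : R).
Hypothesis xbar_r : perm_radius xbar r.
Hypothesis xbar_noninc : nonincreasing_row xbar.
Hypothesis f_sym : forall y, ipnorm rVdot (y - xbar) < r ->
  forall s, fixing_perms xbar s -> f (col_perm s y) = f y.

Lemma cvg_eventually (u w : nat -> \bar R) (l : \bar R) :
  (\forall i \near \oo, u i = w i) -> u @ \oo --> l -> w @ \oo --> l.
Proof. by move=> uw; apply: cvg_trans; exact: near_eq_cvg. Qed.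

Lemma ipcvg_perm s (xs : nat -> 'rV[R]_n) x : ipcvg rVdot xs x ->
  ipcvg rVdot (fun i => col_perm s (xs i)) (col_perm s x).
Proof.
move=> /ipcvgP xsx; apply/ipcvgP => e /xsx; apply: filterS => i.
by rewrite dist_perm.
Qed.

Lemma ipcvg_conj U (xs : nat -> 'rV[R]_n) x : orthogonal_mx U -> ipcvg rVdot xs x ->
  ipcvg symdot (fun i => conj_diag U (xs i)) (conj_diag U x).
Proof.
move=> UU /ipcvgP xsx; apply/ipcvgP => e /xsx; apply: filterS => i.
by rewrite dist_conj.
Qed.

Lemma ipcvg_lambda (Xs : nat -> symmx R n) X : ipcvg symdot Xs X ->
  ipcvg rVdot (lambda \o Xs) (lambda X).
Proof.
move=> /ipcvgP XsX; apply/ipcvgP => e /XsX; apply: filterS => i.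
exact: le_lt_trans (dist_lambda _ _).
Qed.

Lemma subdiff_perm s x v : ipnorm rVdot (x - xbar) < r -> fixing_perms xbar s ->
  subdiff rVdot f x v -> subdiff rVdot f (col_perm s x) (col_perm s v).
Proof.
move=> xr sx [fx [xs [vs [fvs xsx fxs vsv]]]].
have near_r := ipcvg_norm_lt xsx xr.
apply: (@subdiff_eventually _ _ _ _ _ _ (fun i => col_perm s (xs i))
  (fun i => col_perm s (vs i))); first by rewrite f_sym.
- by apply: filterS near_r => i ir; exact: (frechet_perm f_sym).
- exact: ipcvg_perm.
- rewrite f_sym //; apply: cvg_eventually fxs.
  by apply: filterS near_r => i ir /=; rewrite f_sym.
- exact: ipcvg_perm.
Qed.

Lemma subdiff_lambda U x v : orthogonal_mx U -> ipnorm rVdot (x - xbar) < r ->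
  subdiff rVdot f x v ->
  subdiff symdot (f \o lambda) (conj_diag U x) (conj_diag U v).
Proof.
move=> UU xr [fx [xs [vs [fvs xsx fxs vsv]]]].
have near_r := ipcvg_norm_lt xsx xr.
have flE y : ipnorm rVdot (y - xbar) < r -> f (lambda (conj_diag U y)) = f y.
  exact: lambda_conj_value.
apply: (@subdiff_eventually _ _ _ _ _ _ (fun i => conj_diag U (xs i))
  (fun i => conj_diag U (vs i))); first by rewrite /= flE.
- apply: filterS near_r => i ir.
  exact: (frechet_lambda xbar_r xbar_noninc f_sym).
- exact: ipcvg_conj.
- rewrite /= flE //; apply: cvg_eventually fxs.
  by apply: filterS near_r => i ir /=; rewrite flE.
- exact: ipcvg_conj.
Qed.

(** Commutation passes to the limit, so that [X] and [V] have a common [U]; the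
    diagonals of the approximating Frechet subgradients have to be permuted to
    converge, and local symmetry keeps them subgradients. *)
Lemma subdiff_lambda_inv X V : ipnorm rVdot (lambda X - xbar) < r ->
  subdiff symdot (f \o lambda) X V ->
  exists U v, [/\ diagonalizers X U, V = conj_diag U v
    & subdiff rVdot f (lambda X) v].
Proof.
move=> Xr [fX [Xs [Vs [fVs XsX fXs VsV]]]].
have near_r : \forall i \near \oo, ipnorm rVdot (lambda (Xs i) - xbar) < r.
  exact: ipcvg_norm_lt (ipcvg_lambda XsX) Xr.
have XV : (X : 'M[R]_n) *m V = (V : 'M[R]_n) *m X.
  apply: commute_closed => eps e0.
  have [i [Xi Vi]] : exists i, ipnorm symdot (Xs i - X) < eps /\
      ipnorm symdot (Vs i - V) < eps.
    apply: (@filter_ex _ \oo); move/ipcvgP: XsX => /(_ _ e0).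
    by move/ipcvgP: VsV => /(_ _ e0); apply: filterS2 => i Vi Xi.
  exists (Xs i), (Vs i); split=> //.
  by apply: frechet_spectral_comm (fVs i) => Y /= ->.
have [U [XU [v vE]]] := joint_diagonalizer XV; exists U, v; split=> //.
have /choice[Qw QwP] i : exists Qw : 'M[R]_n * 'rV[R]_n,
    diagonalizers (Xs i) Qw.1 /\ (ipnorm rVdot (lambda (Xs i) - xbar) < r ->
      Vs i = conj_diag Qw.1 Qw.2 /\ frechet_subdiff rVdot f (lambda (Xs i)) Qw.2).
  (* Far from [xbar] nothing is claimed of the second component. *)
  have [ir|ir] := ltP (ipnorm rVdot (lambda (Xs i) - xbar)) r; last first.
    by have [Q XQ] := diagonalizerP (Xs i); exists (Q, 0).
  have [Q [w [XQ VE fw]]] :=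
    frechet_lambda_inv xbar_r xbar_noninc f_sym ir (fVs i).
  by exists (Q, w).
have VsE : \forall i \near \oo, Vs i = conj_diag (Qw i).1 (Qw i).2.
  by apply: filterS near_r => i ir; have [_ /(_ ir)[]] := QwP i.
have [ss [ssX ssXs ssw]] := @joint_spectrum_cvg R n X U v Xs (fun i => (Qw i).1)
  (fun i => (Qw i).2) XU (fun i => (QwP i).1) XsX
  (ipcvg_eventually VsE (eq_rect _ (ipcvg symdot Vs) VsV _ vE)).
have ssx i : fixing_perms xbar (ss i) := fixing_perms_near xbar_r Xr (ssX i).
apply: (subdiff_eventually _ _ ssXs _ ssw) => //.
  apply: filterS near_r => i ir; apply: (frechet_perm f_sym) => //.
  by have [_ /(_ ir)[]] := QwP i.
by apply: cvg_eventually fXs; apply: filterS near_r => i ir /=; rewrite f_sym.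
Qed.

End Limiting.

(** * Identifiable sets *)

Lemma entry_le_rVnorm {R : realType} {n : nat} (x : 'rV[R]_n) i :
  `|x 0 i| <= ipnorm rVdot x.
Proof.
rewrite -(ler_pXn2r (n := 2)) ?nnegrE ?ipnorm_ge0 // sqr_ipnorm /= /rVdot.
rewrite real_normK ?num_real // (bigD1 i) //= -expr2 lerDl sumr_ge0 // => k _.
by rewrite -expr2 sqr_ge0.
Qed.

Lemma near_ipnorm {R : realType} {n : nat} (x : 'rV[R]_n) (P : 'rV[R]_n -> Prop) :
  (\forall y \near x, P y) ->
  exists2 r, 0 < r & forall y, ipnorm rVdot (y - x) < r -> P y.
Proof.
move=> /nbhs_ballP[r r0 rP]; exists r => // y yr; apply: rP; split=> // i j.
rewrite !ord1 /ball /= distrC; apply: le_lt_trans yr.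
by have := entry_le_rVnorm (y - x) j; rewrite !mxE.
Qed.

Lemma perm_radius_le {R : realType} {n : nat} (x : 'rV[R]_n) r t :
  perm_radius x r -> 0 < t -> t <= r -> perm_radius x t.
Proof.
move=> [r0 rP] t0 tr; split=> // s st; apply: rP; apply: lt_le_trans st _.
by rewrite ler_pM2l.
Qed.

Section Identifiable.
Context {R : realType} {n : nat} (f : 'rV[R]_n -> \bar R) (M : set 'rV[R]_n).
Variables (Xbar : symmx R n) (U : 'M[R]_n) (vbar : 'rV[R]_n) (r : R).
Let xbar := lambda Xbar.
Let Vbar := conj_diag U vbar.
Hypothesis XbarU : diagonalizers Xbar U.
Hypothesis xbar_r : perm_radius xbar r.
Hypothesis f_sym : forall y, ipnorm rVdot (y - xbar) < r ->
  forall s, fixing_perms xbar s -> f (col_perm s y) = f y.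
Hypothesis M_sym : forall y, ipnorm rVdot (y - xbar) < r ->
  forall s, fixing_perms xbar s -> M (col_perm s y) -> M y.
Hypothesis M_dom : M `<=` edom f.

Let xbar_noninc : nonincreasing_row xbar.
Proof. exact: lambda_noninc. Qed.

Let xbar_near : ipnorm rVdot (xbar - xbar) < r.
Proof. by rewrite subrr ipnorm0; case: xbar_r. Qed.

Lemma subdiff_lambda_bar : subdiff rVdot f xbar vbar ->
  subdiff symdot (f \o lambda) Xbar Vbar.
Proof.
have [UU XE] := XbarU; rewrite [in X in _ -> X]XE.
exact: (subdiff_lambda xbar_r xbar_noninc f_sym).
Qed.

Lemma identifiable_lambda : identifiable rVdot f M xbar vbar ->
  identifiable symdot (f \o lambda) (lambda @^-1` M) Xbar Vbar.
Proof.
move=> idM; have [_ fv _] := idM.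
split; [by move=> X /M_dom|exact: subdiff_lambda_bar|].
move=> Xs Vs fVs XsX fXs VsV.
have near_r : \forall i \near \oo, ipnorm rVdot (lambda (Xs i) - xbar) < r.
  exact: ipcvg_norm_lt (ipcvg_lambda XsX) xbar_near.
have /choice[Qw QwP] i : exists Qw : 'M[R]_n * 'rV[R]_n,
    diagonalizers (Xs i) Qw.1 /\ (ipnorm rVdot (lambda (Xs i) - xbar) < r ->
      Vs i = conj_diag Qw.1 Qw.2 /\ subdiff rVdot f (lambda (Xs i)) Qw.2).
  have [ir|ir] := ltP (ipnorm rVdot (lambda (Xs i) - xbar)) r; last first.
    by have [Q XQ] := diagonalizerP (Xs i); exists (Q, 0).
  have [Q [w [XQ VE fw]]] :=
    subdiff_lambda_inv xbar_r xbar_noninc f_sym ir (fVs i).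
  by exists (Q, w).
have VsE : \forall i \near \oo, Vs i = conj_diag (Qw i).1 (Qw i).2.
  by apply: filterS near_r => i ir; have [_ /(_ ir)[]] := QwP i.
have [ss [ssx ssXs ssw]] := joint_spectrum_cvg XbarU (fun i => (QwP i).1) XsX
  (ipcvg_eventually VsE VsV).
have : \forall i \near \oo, M (col_perm (ss i) (lambda (Xs i))).
  apply: (identifiable_eventually idM _ ssXs _ ssw).
    apply: filterS near_r => i ir; apply: (subdiff_perm f_sym ir (ssx i)).
    by have [_ /(_ ir)[]] := QwP i.
  by apply: cvg_eventually fXs; apply: filterS near_r => i ir /=; rewrite f_sym.
by apply: filterS2 near_r => i ir; apply: M_sym.
Qed.

Lemma identifiable_of_lambda : subdiff rVdot f xbar vbar ->
  identifiable symdot (f \o lambda) (lambda @^-1` M) Xbar Vbar ->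
  identifiable rVdot f M xbar vbar.
Proof.
move=> fv idM; split=> // xs vs fvs xsx fxs vsv.
have [UU XE] := XbarU.
have near_r := ipcvg_norm_lt xsx xbar_near.
have : \forall i \near \oo, (lambda @^-1` M) (conj_diag U (xs i)).
  apply: (identifiable_eventually idM (vs := fun i => conj_diag U (vs i))).
  - apply: filterS near_r => i ir.
    exact: (subdiff_lambda xbar_r xbar_noninc f_sym).
  - by rewrite XE; exact: ipcvg_conj.
  - apply: cvg_eventually fxs; apply: filterS near_r => i ir /=.
    by rewrite (lambda_conj_value xbar_r xbar_noninc f_sym).
  - exact: ipcvg_conj.
apply: filterS2 near_r => i ir /=.
have [s sx ->] := lambda_conj_near UU xbar_noninc xbar_r ir.
exact: M_sym.
Qed.

End Identifiable.

Unset Implicit Arguments.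

Theorem proposition3p17 (R : realType) (n : nat) (f : 'rV[R]_n -> \bar R)
    (Xbar : symmx R n) (M : set 'rV[R]_n) (vbar : 'rV[R]_n) (U : 'M[R]_n) :
  let xbar := lambda Xbar in
  let Vbar := conj_diag U vbar in
  lower_semicontinuous f ->
  locally_symmetric f xbar ->
  M `<=` edom f ->
  locally_symmetric_set M xbar ->
  subdiff rVdot f xbar vbar ->
  diagonalizers Xbar U ->
  subdiff symdot (f \o lambda) Xbar Vbar /\
  (identifiable rVdot f M xbar vbar <->
   identifiable symdot (f \o lambda) (lambda @^-1` M)
     Xbar Vbar).
Proof.
move=> xbar Vbar _ fsym Mdom Msym fv XU.
have [r1 r1P] := perm_radius_exists xbar; have r10 := r1P.1.
have [r2 r20 r2P] := near_ipnorm fsym.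
have [r3 r30 r3P] := near_ipnorm Msym.
pose r := Num.min r1 (Num.min r2 r3).
have xbar_r : perm_radius xbar r.
  apply: perm_radius_le r1P _ _; rewrite ?ge_min ?lexx //.
  by rewrite !lt_min r10 r20 r30.
have f_sym y : ipnorm rVdot (y - xbar) < r ->
    forall s, fixing_perms xbar s -> f (col_perm s y) = f y.
  by rewrite !lt_min => /and3P[_ yr _] s sx; rewrite -(r2P _ yr s sx).
have M_sym y : ipnorm rVdot (y - xbar) < r ->
    forall s, fixing_perms xbar s -> M (col_perm s y) -> M y.
  rewrite !lt_min => /and3P[_ _ yr] s sx Msy.
  have := r3P _ yr s sx; rewrite /indicator (mem_set Msy).
  by case: ifPn => [/set_mem|].
split; first exact: subdiff_lambda_bar XU xbar_r f_sym fv.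
split; first exact: identifiable_lambda XU xbar_r f_sym M_sym Mdom.
exact: identifiable_of_lambda XU xbar_r f_sym M_sym Mdom fv.
Qed.
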